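(* Let $P$ be a finite set and let $\trianglelefteq$ be a quasi-ordering on $P$. Define the binary relation $\vartriangleleft_{\neq}$ on $P$ by: $p\vartriangleleft_{\neq} q$ if and only if $p\trianglelefteq q$ and $p\neq q$. Then the following conditions are equivalent: (i) There exists a finite atomistic lattice $L$ such that $\langle P,\trianglelefteq,\vartriangleleft_{\neq}\rangle\cong\langle \mathrm{At}(L),\trianglelefteq_L,D_L\rangle$ (that is, there is a bijection $P\to \mathrm{At}(L)$ which is simultaneously an isomorphism from $\trianglelefteq$ to $\trianglelefteq_L$ and from $\vartriangleleft_{\neq}$ to $D_L$). (ii) There exists a finite lattice $L$ such that $\langle P,\trianglelefteq\rangle\cong\langle \mathrm{J}(L),\trianglelefteq_L\rangle$. (iii) $|\{x\in P : p\trianglelefteq x\}|\neq 2$ for all $p\in P$.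
   Context: A quasi-ordering is a reflexive and transitive binary relation. For a finite lattice $L$, $\mathrm{J}(L)$ is the set of all (nonzero) join-irreducible elements of $L$; for $q\in \mathrm{J}(L)$, $q_*$ denotes the unique element of $L$ covered by $q$. The join-dependency relation $D_L$ is the binary relation on $\mathrm{J}(L)$ defined by: $p\mathrel{D_L}q$ if and only if $p\neq q$ and there exists $x\in L$ such that $p\leq q\vee x$ and $p\nleq q_*\vee x$. The relation $\trianglelefteq_L$ is the reflexive and transitive closure of $D_L$ on $\mathrm{J}(L)$. A finite lattice is atomistic if every element is a (finite, possibly empty) join of atoms; $\mathrm{At}(L)$ denotes the set of atoms of $L$, and $\mathrm{At}(L)=\mathrm{J}(L)$ when $L$ is finite atomistic. *)

(* Defs.v *)
From mathcomp Require Import all_boot all_order.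

Set Implicit Arguments.
Unset Strict Implicit.
Unset Printing Implicit Defensive.

Import Order.TTheory.
Local Open Scope order_scope.

Section Elements.
Context {d : Order.disp_t} {L : finTBLatticeType d}.
Implicit Types x y z a q : L.

Definition covered x y : bool := (x < y) && ~~ [exists z, x < z < y].

Definition atom a : bool := covered \bot a.

Definition join_irr q : bool :=
  (q != \bot) &&
  [forall x, forall y, (q == x `|` y) ==> (q == x) || (q == y)].

(* For join-irreducible [q] this is the element q_* of the literature, see
   [lower_coverP]; the default value is irrelevant in that case. *)
Definition lower_cover q : L := odflt \bot [pick y | covered y q].

Lemma join_irrP q x y : join_irr q -> q = x `|` y -> q = x \/ q = y.
Proof.
case/andP=> _ /forallP/(_ x)/forallP/(_ y)/implyP qJ /eqP/qJ.
by case/orP=> /eqP; [left | right].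
Qed.

Lemma le_joins_lt q y : y < q -> y <= \join_(z | z < q) z.
Proof. by move=> yq; apply: (@joins_min _ _ _ y). Qed.

Lemma joins_lt q : join_irr q -> \join_(z | z < q) z < q.
Proof.
move=> qJ; apply: (big_ind (fun t => t < q)) => //.
  by rewrite lt0x; case/andP: qJ.
move=> x y xq yq; rewrite lt_neqAle leUx (ltW xq) (ltW yq) !andbT.
apply/eqP => /esym/(join_irrP qJ) [] E.
  by rewrite -E ltxx in xq.
by rewrite -E ltxx in yq.
Qed.

Lemma lower_coverP q :
  join_irr q -> forall y, covered y q = (y == lower_cover q).
Proof.
move=> qJ.
have covE y : covered y q = (y == \join_(z | z < q) z).
  apply/idP/eqP => [/andP[yq /existsPn ncov] | ->].
    apply/eqP; rewrite eq_le (le_joins_lt yq) /=.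
    have := ncov (\join_(z | z < q) z); rewrite joins_lt // andbT.
    by rewrite lt_def (le_joins_lt yq) andbT negbK => /eqP->.
  rewrite /covered joins_lt //=; apply/existsPn => z.
  apply/negP => /andP[lt1 /le_joins_lt le1].
  by have := lt_le_trans lt1 le1; rewrite ltxx.
move=> y; rewrite /lower_cover; case: pickP => [z /= | noc].
  by rewrite !covE => /eqP->.
by have := noc (\join_(z | z < q) z); rewrite covE eqxx.
Qed.

Lemma atom_join_irr a : atom a -> join_irr a.
Proof.
case/andP; rewrite lt0x => a0 /existsPn ncov; rewrite /join_irr a0 /=.
apply/forallP => x; apply/forallP => y; apply/implyP => /eqP axy.
have xa : x <= a by rewrite axy leUl.
have := ncov x; rewrite lt0x lt_neqAle xa andbT [x == a]eq_sym.
by case: eqVneq => [x0 | _] /=; [rewrite axy x0 join0x eqxx orbT | rewrite negbK => ->].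
Qed.

End Elements.

Section Relations.
Context {d : Order.disp_t}.
Variable L : finTBLatticeType d.

Definition atomistic : Prop :=
  forall x : L, exists2 A : {set L},
    {in A, forall a, atom a} & x = \join_(a in A) a.

Definition J := {q : L | join_irr q}.

Definition At := {a : L | atom a}.

Definition J_of_At (a : At) : J := exist _ (sval a) (atom_join_irr (svalP a)).

Definition join_dep : rel J := fun p q =>
  (p != q) &&
  [exists x : L, (sval p <= sval q `|` x) &&
                 ~~ (sval p <= lower_cover (sval q) `|` x)].

Definition join_dep_star : rel J := connect join_dep.

Definition join_dep_At : rel At := relpre J_of_At join_dep.

(* The closure is taken in J(L) and then restricted to atoms; when L is
   atomistic, every join-irreducible is an atom. *)
Definition join_dep_star_At : rel At := relpre J_of_At join_dep_star.

End Relations.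

(* Main.v *)
Require Import Defs.
From HB Require Import structures.
From mathcomp Require Import all_boot all_order.

Set Implicit Arguments.
Unset Strict Implicit.
Unset Printing Implicit Defensive.

Import Order.TTheory.

(** Only (ii) => (iii) and (iii) => (i) carry content; (i) => (ii) holds because
    every join-irreducible element of an atomistic lattice is an atom.

    For (ii) => (iii), suppose that [p] has exactly one element [q] other than
    itself above it for the quasi-ordering. Then [p] depends on [q], as witnessed
    by [x] with [p <= q `|` x] and [~~ (p <= q_* `|` x)]. In particular [p] lies
    neither below [q] nor below [x], and [q] does not lie below [x]. Shrinking
    the part of the join that comes from [x] yields a join-irreducible [s <= x]
    on which [p] depends ([join_dep_of_cover]), and [s] differs from [q]: a
    third element above [p].

    For (iii) => (i), call a subset [X] of [P] pair-closed when it contains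
    every [w] such that [X] contains two distinct elements, both different from
    [w] and both above [w]. The pair-closed sets form a lattice under inclusion,
    the empty set and the singletons are pair-closed, and so this lattice is
    atomistic with the singletons as atoms. If [q] is above [p] and
    different from it, then by (iii) so is some [y] other than [q], and [{q, y}] generates [p]
    whereas [{y}] does not contain it, so that [{p}] depends on [{q}].
    Conversely, the union of a pair-closed set with the set of all elements
    below [q] is again pair-closed, so [{p}] depends on [{q}] only when [p] is
    below [q]. The join-dependency relation is thus the quasi-ordering restricted
    to pairs of distinct elements, and its reflexive transitive closure is the quasi-ordering
    ([mono_join_dep_star]). *)

Lemma inj_surj_bij (T : choiceType) (U : eqType) (f : T -> U) :
  injective f -> (forall u, exists t, f t == u) -> bijective f.
Proof.
move=> f_inj f_surj; have fK u := eqP (xchooseP (f_surj u)).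
by exists (fun u => xchoose (f_surj u)) => [t | u] //; apply: f_inj.
Qed.

Lemma set2_partner (T : finType) (A : {set T}) (p : T) :
  p \in A -> #|A| = 2 -> exists2 q, q != p & A = [set p; q].
Proof.
move=> pA /eqP/cards2P[x [y [xy AE]]]; move: pA; rewrite AE !inE.
case/orP=> /eqP->; first by exists y; rewrite // eq_sym.
by exists x; rewrite // setUC.
Qed.

(** * Join-dependency in a finite lattice *)

Section JoinDependency.
Context {d : Order.disp_t} {L : finTBLatticeType d}.
Implicit Types (x y a s : L) (p q : J L).
Local Open Scope order_scope.

Lemma exists_minimal (Q : pred L) x :
  Q x -> exists2 m, Q m & forall y, y < m -> ~~ Q y.
Proof.
move=> Qx; pose h y := #|[set z | z <= y]|.
case: (arg_minnP h Qx) => m Qm m_min; exists m => // y ym.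
suff lt_h : (h y < h m)%N by apply: contraTN lt_h => /m_min; rewrite -leqNgt.
apply/proper_card/properP; split; last by exists m; rewrite !inE // lt_geF.
by apply/subsetP => z; rewrite !inE => /le_trans; apply; apply: ltW.
Qed.

Lemma lower_cover_lt s : join_irr s -> lower_cover s < s.
Proof. by move=> /lower_coverP/(_ (lower_cover s)); rewrite eqxx => /andP[]. Qed.

Lemma lt_le_lower_cover s y : join_irr s -> y < s -> y <= lower_cover s.
Proof.
move=> sJ ys; suff /eqP<-: \join_(z | z < s) z == lower_cover s by exact: le_joins_lt.
rewrite -lower_coverP // /covered joins_lt //=; apply/existsPn => z.
by apply/negP => /andP[lt1 /le_joins_lt]; rewrite lt_geF.
Qed.

Lemma atom_lower_cover a : atom a -> lower_cover a = \bot.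
Proof.
move=> aA; apply/esym/eqP; rewrite -lower_coverP //.
exact: atom_join_irr.
Qed.

(** A nontrivial join cover [p <= x `|` a] of [p] yields a dependency of [p] on
    some join-irreducible below [x]. *)
Lemma join_dep_of_cover p x a :
    val p <= x `|` a -> ~~ (val p <= x) -> ~~ (val p <= a) ->
  exists2 s : J L, val s <= x & join_dep p s.
Proof.
move=> pxa px pa.
(* A minimal [s] is sought among the elements of the interval from [\bot] to
   [x] such that [s `|` y] is a cover of [p] for some [y] not above [p]. *)
pose Q s := (s <= x) && [exists y, (val p <= s `|` y) && ~~ (val p <= y)].
have Qx : Q x by rewrite /Q lexx; apply/existsP; exists a; rewrite pxa.
have [s /andP[sx /existsP[y /andP[psy py]]] s_min] := exists_minimal Qx.
have s_minP t z : t < s -> ~~ (val p <= z) -> ~~ (val p <= t `|` z).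
  move=> ts pz; apply: contraNN (s_min t ts) => ptz.
  by rewrite /Q (le_trans (ltW ts) sx); apply/existsP; exists z; rewrite ptz.
have sJ : join_irr s.
  apply/andP; split; first by apply: contraNneq py => s0; rewrite s0 join0x in psy.
  apply/forallP => b; apply/forallP => c; apply/implyP => /eqP sbc.
  apply: contraTT psy; rewrite negb_or => /andP[sb sc].
  have bs : b < s by rewrite lt_def sb sbc leUl.
  have cs : c < s by rewrite lt_def sc sbc leUr.
  by rewrite sbc -joinA; apply: (s_minP) => //; exact: s_minP.
exists (exist _ s sJ) => //; apply/andP; split.
  by apply: contraNneq px => ->.
apply/existsP; exists y; rewrite psy /=; apply: s_minP => //.
exact: lower_cover_lt.
Qed.

(** The dependency set of a join-irreducible element is never a singleton. *)
Lemma join_dep_other p q :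
  join_dep p q -> exists2 s, s != q & join_dep p s.
Proof.
case/andP=> pq /existsP[x /andP[pqx pnqx]].
have [qJ px] : join_irr (val q) /\ ~~ (val p <= x).
  by split; [exact: valP | apply: contraNN pnqx => /lexUr->].
have pnq : ~~ (val p <= val q).
  apply: contraNN pnqx => p_le_q; apply: lexUl; apply: lt_le_lower_cover => //.
  by rewrite lt_neqAle p_le_q andbT; apply: contraNneq pq => /val_inj->.
rewrite joinC in pqx; have [s sx ps] := join_dep_of_cover pqx px pnq.
exists s => //; apply: contraNneq px => sq; rewrite (le_trans pqx) //.
by rewrite leUx lexx -sq.
Qed.

Lemma atomistic_join_irr_atom a : atomistic L -> join_irr a -> atom a.
Proof.
move=> /(_ a)[A A_at aE] aJ; suff: a \in A by exact: A_at.
have jlt : {in A, forall z, z <= a} by move=> z zA; rewrite aE; exact: joins_sup.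
apply: contraLR (joins_lt aJ) => aA; suff /le_gtF-> : a <= \join_(z | z < a) z by [].
rewrite {1}aE; apply/joinsP => z zA; apply: joins_sup.
by rewrite lt_neqAle jlt // andbT; apply: contraNneq aA => <-.
Qed.

(** If [join_dep] corresponds to a quasi-ordering restricted to pairs of distinct
    elements, then its reflexive transitive closure corresponds to the
    quasi-ordering itself. *)
Lemma mono_join_dep_star (P : finType) (r : rel P) (h : P -> J L) :
    reflexive r -> transitive r -> bijective h ->
    (forall i j, join_dep (h i) (h j) = r i j && (i != j)) ->
  {mono h : i j / r i j >-> join_dep_star i j}.
Proof.
move=> r_refl r_trans [g hK gK] h_dep i j; apply/idP/idP; last first.
  have [-> | ij rij] := eqVneq i j; first by rewrite /join_dep_star connect0.
  by apply: connect1; rewrite h_dep rij.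
case/connectP=> s; elim: s i => [|t s IHs] i /=.
  by move=> _ /(can_inj hK)->.
rewrite -[t]gK h_dep => /andP[/andP[rit _] /IHs] IH /IH.
exact: r_trans.
Qed.

End JoinDependency.

(** * The lattice of pair-closed sets *)

Section PairClosed.
Context {P : finType} (r : rel P).
Implicit Types (X Y A : {set P}) (p q w x y : P).

(** Every [w] below two distinct elements of [X], both different from [w], lies
    in [X]; that is, every pair [{x, y}] is a join cover of each [w] below both
    [x] and [y]. *)
Definition pair_closed X : bool :=
  [forall w, forall x in X, forall y in X,
     [&& x != y, x != w, y != w, r w x & r w y] ==> (w \in X)].

Lemma pair_closedP X :
  reflect (forall w x y, x \in X -> y \in X -> x != y -> x != w -> y != w ->
             r w x -> r w y -> w \in X)
          (pair_closed X).
Proof.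
apply: (iffP forallP) => [Xc w x y xX yX xy xw yw wx wy | Xc w].
  move: (Xc w) => /forall_inP/(_ x xX)/forall_inP/(_ y yX)/implyP; apply.
  by rewrite xy xw yw wx wy.
apply/forall_inP => x xX; apply/forall_inP => y yX.
by apply/implyP => /and5P[]; apply: Xc.
Qed.

Lemma pair_closed0 : pair_closed set0.
Proof. by apply/pair_closedP => w x y; rewrite inE. Qed.

Lemma pair_closedT : pair_closed setT.
Proof. by apply/pair_closedP => w x y; rewrite !inE. Qed.

Lemma pair_closed1 p : pair_closed [set p].
Proof.
by apply/pair_closedP => w x y; rewrite !inE => /eqP-> /eqP->; rewrite eqxx.
Qed.

Lemma pair_closed_bigcap (I : finType) (Q : pred I) (F : I -> {set P}) :
  (forall i, Q i -> pair_closed (F i)) -> pair_closed (\bigcap_(i | Q i) F i).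
Proof.
move=> Fc; apply/pair_closedP => w x y /bigcapP xF /bigcapP yF xy xw yw wx wy.
apply/bigcapP => i Qi.
exact: (pair_closedP _ (Fc i Qi)) (xF i Qi) (yF i Qi) xy xw yw wx wy.
Qed.

Lemma pair_closedI X Y :
  pair_closed X -> pair_closed Y -> pair_closed (X :&: Y).
Proof.
move=> /pair_closedP Xc /pair_closedP Yc; apply/pair_closedP => w x y.
rewrite !inE => /andP[xX xY] /andP[yX yY] xy xw yw wx wy.
by rewrite (Xc w x y) ?(Yc w x y).
Qed.

(** If one of two elements above [w] is below [q], then so is [w]; otherwise
    both elements lie in [X]. *)
Lemma pair_closedU_down (r_trans : transitive r) X q :
  pair_closed X -> pair_closed (X :|: [set z | r z q]).
Proof.
move=> /pair_closedP Xc; apply/pair_closedP => w x y; rewrite !inE.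
move=> /orP[xX | xq] /orP[yX | yq] xy xw yw wx wy.
- by rewrite (Xc w x y).
- by rewrite (r_trans _ _ _ wy yq) orbT.
- by rewrite (r_trans _ _ _ wx xq) orbT.
- by rewrite (r_trans _ _ _ wx xq) orbT.
Qed.

(** The least pair-closed set containing [A], see [pair_hull_sub]. *)
Definition pair_hull A : {set P} :=
  \bigcap_(X : {set P} | pair_closed X && (A \subset X)) X.

Lemma pair_hull_closed A : pair_closed (pair_hull A).
Proof. by apply: pair_closed_bigcap => X /andP[]. Qed.

Lemma pair_hull_sub A X : pair_closed X -> (pair_hull A \subset X) = (A \subset X).
Proof.
move=> Xc; apply/idP/idP => [|AX]; last by apply: bigcap_inf; rewrite Xc.
by apply: subset_trans; apply/bigcapsP => Y /andP[].
Qed.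

(** Pair-closed subsets of [P], ordered by inclusion. *)
Record closed_set := ClosedSet { cset :> {set P}; _ : pair_closed cset }.

HB.instance Definition _ := [isSub for cset].
HB.instance Definition _ := [Finite of closed_set by <:].

Implicit Types U V W : closed_set.

Lemma closed_setP U : pair_closed U. Proof. exact: valP. Qed.

Definition cle U V : bool := cset U \subset cset V.

Fact cle_refl : reflexive cle. Proof. by move=> U; rewrite /cle. Qed.

Fact cle_anti : antisymmetric cle.
Proof. by move=> U V /andP[UV VU]; apply/val_inj/eqP; rewrite eqEsubset; apply/andP. Qed.

Fact cle_trans : transitive cle. Proof. by move=> V U W; apply: subset_trans. Qed.

Fact closed_set_display : Order.disp_t. Proof. exact: Order.Disp tt tt. Qed.

HB.instance Definition _ :=
  Order.Le_isPOrder.Build closed_set_display closed_set cle_refl cle_anti cle_trans.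

Definition cmeet U V := ClosedSet (pair_closedI (closed_setP U) (closed_setP V)).
Definition cjoin U V := ClosedSet (pair_hull_closed (U :|: V)).

Fact cle_meet U V W : cle U (cmeet V W) = cle U V && cle U W.
Proof. exact: subsetI. Qed.

Fact cle_join U V W : cle (cjoin U V) W = cle U W && cle V W.
Proof. by rewrite /cle pair_hull_sub ?closed_setP // subUset. Qed.

HB.instance Definition _ :=
  Order.POrder_MeetJoin_isLattice.Build closed_set_display closed_set cle_meet cle_join.

Definition cbot := ClosedSet pair_closed0.
Definition ctop := ClosedSet pair_closedT.

Fact cle_bot U : cle cbot U. Proof. exact: sub0set. Qed.
Fact cle_top U : cle U ctop. Proof. exact: subsetT. Qed.

HB.instance Definition _ := Order.hasBottom.Build closed_set_display closed_set cle_bot.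
HB.instance Definition _ := Order.hasTop.Build closed_set_display closed_set cle_top.

Definition cset1 p := ClosedSet (pair_closed1 p).

Local Open Scope order_scope.

Lemma le_cset1 p U : (cset1 p <= U) = (p \in cset U).
Proof. exact: sub1set. Qed.

Lemma closed_set_gt0 U : (\bot < U) = (cset U != set0).
Proof. by rewrite lt0x. Qed.

Lemma mem_cset1_atom U p : atom U -> p \in cset U -> cset1 p = U.
Proof.
case/andP=> _ /existsPn/(_ (cset1 p)); rewrite closed_set_gt0 -le_cset1 => nlt pU.
apply/eqP; move: nlt; rewrite lt_neqAle pU andbT /=.
have -> : [set p] != set0 by apply/set0Pn; exists p; rewrite inE.
by rewrite negbK.
Qed.

Lemma cset1_atom p : atom (cset1 p).
Proof.
rewrite /atom /covered closed_set_gt0; apply/andP; split.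
  by apply/set0Pn; exists p; rewrite inE.
apply/existsPn => U; rewrite closed_set_gt0; apply/negP => /andP[/set0Pn[x xU]].
rewrite lt_leAnge => /andP[Up]; rewrite le_cset1.
by have /set1P <- := subsetP Up x xU; rewrite xU.
Qed.

(** The singleton of [p] as an atom of the lattice of pair-closed sets. *)
Definition At1 p : At closed_set := exist _ (cset1 p) (cset1_atom p).

Lemma At1_bij : bijective At1.
Proof.
apply: inj_surj_bij => [p q [/set1_inj] // | [U UA]].
have := UA; rewrite /atom /covered closed_set_gt0 => /andP[/set0Pn[p pU] _].
by exists p; rewrite -val_eqE /= (mem_cset1_atom UA pU).
Qed.

Lemma closed_set_atomistic : atomistic closed_set.
Proof.
move=> U; exists [set cset1 p | p in cset U].
  by move=> _ /imsetP[p _ ->]; exact: cset1_atom.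
apply/eqP; rewrite eq_le; apply/andP; split; last first.
  by apply/joinsP => _ /imsetP[p pU ->]; rewrite le_cset1.
apply/subsetP => p pU; rewrite -le_cset1; apply: (@joins_min _ _ _ (cset1 p)) => //.
exact: imset_f.
Qed.

(** Condition (iii) is needed only from right to left, where it provides the
    second element [y] of a cover of [p] by [q] and [y]. *)
Lemma join_dep_At1 :
    reflexive r -> transitive r -> (forall p, #|[set x | r p x]| <> 2) ->
  forall p q, join_dep_At (At1 p) (At1 q) = r p q && (p != q).
Proof.
move=> r_refl r_trans r2 p q.
rewrite /join_dep_At /join_dep /= -val_eqE /= atom_lower_cover ?cset1_atom //.
have -> : (cset1 p == cset1 q) = (p == q).
  by apply/eqP/eqP => [[/set1_inj] | ->].
rewrite andbC; apply: andb_id2r => pq; apply/existsP/idP => [[U] | rpq].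
  rewrite join0x !le_cset1 => /andP[pqU pU].
  (* The elements of [U] and those below [q] form a pair-closed set containing
     [U] and [q], hence [p], which is not in [U]. *)
  have Vc := pair_closedU_down r_trans q (closed_setP U).
  have qUV : cset1 q `|` U <= ClosedSet Vc.
    by rewrite leUx le_cset1 !inE r_refl orbT; apply: subsetUl.
  by have := subsetP qUV p pqU; rewrite !inE (negPf pU).
have [y rpy /andP[yp yq]] : exists2 y, r p y & (y != p) && (y != q).
  apply/exists_inP; apply: contra_notT (r2 p) => /exists_inPn none.
  suff -> : [set x | r p x] = [set p; q] by rewrite cards2 pq.
  apply/setP => y; rewrite !inE; apply/idP/idP => [/none | /orP[] /eqP-> //].
  by rewrite negb_and !negbK.
exists (cset1 y); rewrite join0x !le_cset1 inE [p == y]eq_sym yp andbT.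
apply: (pair_closedP _ (closed_setP _) _ q y) => //; rewrite -?le_cset1 ?leUl ?leUr //.
  by rewrite eq_sym.
by rewrite eq_sym.
Qed.

End PairClosed.

Theorem theorem3p1 (P : finType) (r : rel P)
    (r_refl : reflexive r) (r_trans : transitive r) :
  let r_neq : rel P := fun p q => r p q && (p != q) in
  [<-> (exists (d : Order.disp_t) (L : finTBLatticeType d),
          atomistic L /\
          exists f : P -> At L,
            [/\ bijective f,
                {mono f : p q / r p q >-> join_dep_star_At p q} &
                {mono f : p q / r_neq p q >-> join_dep_At p q}]);
       (exists (d : Order.disp_t) (L : finTBLatticeType d),
          exists f : P -> J L,
            bijective f /\ {mono f : p q / r p q >-> join_dep_star p q});
       (forall p : P, #|[set x | r p x]| <> 2)].
Proof.
have At_J d (L : finTBLatticeType d) : atomistic L -> bijective (@J_of_At d L).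
  move=> Lat; apply: inj_surj_bij => [a b [ab] | [q qJ]]; first exact: val_inj.
  by exists (exist _ q (atomistic_join_irr_atom Lat qJ)); rewrite -val_eqE.
move=> r_neq; tfae.
- case=> d [L [Lat [f [f_bij f_star _]]]]; exists d, L, (@J_of_At d L \o f).
  by split=> //; apply: bij_comp => //; apply: At_J.
- case=> d [L [f [[g fK gK] f_star]]] p p2.
  have p_up : p \in [set x | r p x] by rewrite inE.
  have [q qp pE] := set2_partner p_up p2.
  have only_q t : join_dep (f p) t -> t = f q.
    move=> pt; have := connect1 pt; rewrite -/(join_dep_star _ _) -[t]gK f_star.
    move=> rpt; have : g t \in [set x | r p x] by rewrite inE.
    rewrite pE !inE => /orP[] /eqP tE; last by rewrite tE.
    by move: pt; rewrite -[t]gK tE /join_dep eqxx.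
  have pq : join_dep (f p) (f q).
    (* Along a chain from [f p] to [f q], the first step leads to [f q]. *)
    have: join_dep_star (f p) (f q).
      by rewrite f_star; have := set22 p q; rewrite -pE inE.
    case/connectP=> [[|t s]] /=.
      by move=> _ /(can_inj fK)/eqP; rewrite (negPf qp).
    by case/andP=> pt _ _; rewrite -(only_q t pt).
  have [s sq /only_q sE] := join_dep_other pq.
  by rewrite sE eqxx in sq.
- move=> r2; exists (closed_set_display), (closed_set r : finTBLatticeType _).
  have dep := join_dep_At1 r_refl r_trans r2.
  have Lat := @closed_set_atomistic P r.
  split=> //; exists (At1 r); split=> //; first exact: At1_bij.
  apply: (mono_join_dep_star (h := @J_of_At _ _ \o At1 r)) => //.
  by apply: bij_comp; [apply: At_J | apply: At1_bij].
Qed.
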